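(* Let $G$ be a group, $A\subseteq G$, and let $F$ be a finite subset of $G$. Then $\Delta(FA)=F\,\Delta(A)\,F^{-1}$.
   Context: For a group $G$ and $A\subseteq G$, $\Delta(A)=\{g\in G:|gA\cap A|=\infty\}$; $FA=\{fa:f\in F,a\in A\}$ and $F\Delta(A)F^{-1}=\{f_1gf_2^{-1}:f_1,f_2\in F,\ g\in\Delta(A)\}$. *)

(* Defs.v *)
From mathcomp Require Import all_boot.
From mathcomp Require Import classical_sets cardinality.

Set Implicit Arguments.
Unset Strict Implicit.
Unset Printing Implicit Defensive.

Local Open Scope group_scope.
Local Open Scope classical_set_scope.

(* [groupType] is not restricted to finite groups; the choice structure it
   carries exists classically on every type. *)

Definition set_translate (G : groupType) (g : G) (A : set G) : set G :=
  [set g * a | a in A].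

Definition set_mul (G : groupType) (F A : set G) : set G :=
  [set f * a | f in F & a in A].

Definition Delta (G : groupType) (A : set G) : set G :=
  [set g | infinite_set (set_translate g A `&` A)].

Definition set_two_sided (G : groupType) (F D : set G) : set G :=
  [set h | exists f1 g f2, [/\ F f1, D g, F f2 & h = f1 * g * f2^-1]].

(* Main.v *)
(** [gFA ∩ FA] is the union over [f1, f2 ∈ F] of the sets
    [g f2 A ∩ f1 A = f1 ((f1^-1 g f2) A ∩ A)]; as [F] is finite, the union is
    infinite iff some [f1^-1 g f2] lies in [Delta A]. *)
Require Import Defs.
From mathcomp Require Import all_boot.
From mathcomp Require Import boolp classical_sets cardinality.

Local Open Scope group_scope.
Local Open Scope classical_set_scope.

(** Left translation preserves finiteness, so in the decomposition [set_translate_mulI] the piece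
    indexed by [f1], [f2] is infinite iff [f1^-1 * g * f2] lies in [Delta A], that is, iff [g] lies
    in [f1 (Delta A) f2^-1]. *)

Lemma finite_set_translate (G : groupType) (g : G) (A : set G) :
  finite_set (set_translate g A) <-> finite_set A.
Proof.
split=> [fin_gA|]; last exact: finite_image.
apply: sub_finite_set (finite_image (fun x => g^-1 * x) fin_gA) => a Aa.
by exists (g * a); [exists a | rewrite mulKg].
Qed.

Lemma set_translate_mulI (G : groupType) (g : G) (A F : set G) :
  set_translate g (set_mul F A) `&` set_mul F A =
  \bigcup_(f1 in F) \bigcup_(f2 in F)
    set_translate f1 (set_translate (f1^-1 * g * f2) A `&` A).
Proof.
apply/seteqP; split=> [x [[_ [f2 Ff2 [a Aa <-]] <-] [f1 Ff1 [b Ab eq_ba]]]|].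
  exists f1 => //; exists f2 => //; exists b => //; split=> //.
  (* From [f1 * b = g * (f2 * a)] one gets [b = (f1^-1 * g * f2) * a]. *)
  by exists a => //; rewrite -!mulgA -eq_ba mulKg.
move=> x [f1 Ff1 [f2 Ff2 [b [[a Aa def_b] Ab] <-]]]; split; last first.
  by exists f1 => //; exists b.
exists (f2 * a); first by exists f2 => //; exists a.
by rewrite -def_b -!mulgA mulVKg.
Qed.

Theorem theorem1p4 (G : groupType) (A F : set G) (finF : finite_set F) :
  Delta (set_mul F A) = set_two_sided F (Delta A).
Proof.
apply/seteqP; split=> [g infg | _ [f1 [g [f2 [Ff1 infg Ff2 ->]]]]].
  (* If no piece is infinite, the union over the finite set of pairs from [F] is finite. *)
  apply: contrapT => notin; apply: infg; rewrite set_translate_mulI.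
  apply: bigcup_finite => // f1 Ff1; apply: bigcup_finite => // f2 Ff2.
  apply/finite_set_translate; apply: contrapT => inf12; apply: notin.
  exists f1, (f1^-1 * g * f2), f2; split=> //.
  by rewrite -!mulgA mulgV mulg1 mulVKg.
rewrite /Delta /= set_translate_mulI => fin_union; apply: infg.
(* One piece suffices: for [h = f1 * g * f2^-1], [f1^-1 * h * f2 = g], so the union contains
   [f1 (gA ∩ A)]. *)
apply/(finite_set_translate _ f1 _); apply: sub_finite_set fin_union => x gx.
exists f1 => //; exists f2 => //.
by rewrite !mulgA mulVg mul1g mulgVK.
Qed.
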